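(* Let $F(x,y)$ be a binary form of degree $n\geq 3$ with rational integer coefficients such that $f(x)=F(x,1)$ has leading coefficient $1$ and distinct real roots $\alpha_1,\ldots,\alpha_n$. Let $0<\varepsilon<1$, $0<\eta<1$ and $K\geq 1$ be real numbers, and let $A,B,C,C_1,C_2,D,E$ be the constants \[ A=\min_{i\neq j}|\alpha_i-\alpha_j|,\qquad B=\min_i\prod_{j\neq i}|\alpha_j-\alpha_i|,\qquad C=\max\left\{\frac{K}{(1-\varepsilon)^{n-1}B},\,1\right\}, \] \[ C_1=\max\left\{\frac{K^{1/n}}{\varepsilon A},\,(2C)^{1/(n-2)}\right\},\qquad C_2=\max\left\{\frac{K^{1/n}}{\varepsilon A},\,C^{1/(n-2)}\right\}, \] \[ D=\left(\frac{K}{\eta(1-\varepsilon)^{n-1}AB}\right)^{1/n},\qquad E=\frac{(1+\eta)^{n-1}K}{(1-\varepsilon)^{n-1}}. \] Let $m>1$ be a squarefree positive integer, $M=\mathbb{Q}(i\sqrt{m})$, and let $\mathbb{Z}_M$ be the ring of integers of $M$. Let $(x,y)\in\mathbb{Z}_M^2$ be a solution of \[ |F(x,y)|\leq K, \] and let $x_1,x_2,y_1,y_2\in\mathbb{Z}$ be the integer coordinates of $x,y$, i.e. \[ x=x_1+x_2\frac{1+i\sqrt{m}}{2},\quad y=y_1+y_2\frac{1+i\sqrt{m}}{2}\qquad\text{if } m\equiv 3 \pmod 4, \] \[ x=x_1+x_2\,i\sqrt{m},\quad y=y_1+y_2\,i\sqrt{m}\qquad\text{if } m\equiv 1,2 \pmod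 4. \] Assume that $|y|>C_1$ if $m\equiv 3\pmod 4$, and that $|y|>C_2$ if $m\equiv 1,2\pmod 4$. Then \[ x_2y_1=x_1y_2. \] I. Further, if $m\equiv 3\pmod 4$, then the following holds: IA1. If $2y_1+y_2=0$, then $2x_1+x_2=0$ and $|F(x_2,y_2)|\leq \dfrac{2^nK}{(\sqrt{m})^n}$. IA2. If $|2y_1+y_2|\geq 2D$, then $|F(2x_1+x_2,\,2y_1+y_2)|\leq 2^nE$. IB1. If $y_2=0$, then $x_2=0$ and $|F(x_1,y_1)|\leq K$. IB2. If $|y_2|\geq \dfrac{2}{\sqrt{m}}D$, then $|F(x_2,y_2)|\leq \dfrac{2^n}{(\sqrt{m})^n}E$. II. If $m\equiv 1,2\pmod 4$, then the following holds: IIA1. If $y_1=0$, then $x_1=0$ and $|F(x_2,y_2)|\leq \dfrac{K}{(\sqrt{m})^n}$. IIA2. If $|y_1|\geq D$, then $|F(x_1,y_1)|\leq E$. IIB1. If $y_2=0$, then $x_2=0$ and $|F(x_1,y_1)|\leq K$. IIB2. If $|y_2|\geq \dfrac{D}{\sqrt{m}}$, then $|F(x_2,y_2)|\leq \dfrac{E}{(\sqrt{m})^n}$.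
   Context: A binary form of degree $n$ is a homogeneous polynomial of degree $n$ in two variables. The field $M=\mathbb{Q}(i\sqrt m)$ is regarded as a subfield of $\mathbb{C}$, and $|\cdot|$ denotes the usual complex absolute value. The indices $i,j$ in the minima and products defining $A$ and $B$ range over $1,\ldots,n$. Every element of $\mathbb{Z}_M$ has a unique representation with integer coordinates of the form given in the statement. *)

(* Defs.v *)
From HB Require Import structures.
From mathcomp Require Import all_boot all_order all_algebra.
From mathcomp Require Import reals exp.
From mathcomp Require Import complex.
From mathcomp Require Import mpoly.

Set Implicit Arguments.
Unset Strict Implicit.
Unset Printing Implicit Defensive.

Import Order.TTheory GRing.Theory Num.Theory.
Local Open Scope ring_scope.
Local Open Scope complex_scope.

Definition binary_form (n : nat) (F : {mpoly int[2]}) : Prop :=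
  F \is n.-homog.

(* The first variable is the one of index 0.  With S := {poly int}, x := 'X and
   y := 1 this is the polynomial F(X, 1). *)
Definition form_eval (S : comNzRingType) (F : {mpoly int[2]}) (x y : S) : S :=
  mmap (intr : int -> S) (fun i : 'I_2 => if i == ord0 then x else y) F.

Definition dehomogenize (F : {mpoly int[2]}) : {poly int} :=
  form_eval F 'X 1.

Definition squarefree (m : nat) : Prop :=
  forall d : nat, (d ^ 2 %| m)%N -> d = 1%N.

(* The junk value 0 is only taken when no index satisfies P. *)
Definition fin_min (R : realType) (I : finType) (P : pred I) (g : I -> R) : R :=
  if [pick i | P i] is Some i0 then g [arg min_(i < i0 | P i) g i]%O else 0.

Section Constants.
Variables (R : realType) (n : nat) (alpha : 'I_n -> R) (eps eta K : R).

Definition constA : R :=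
  fin_min (fun p : 'I_n * 'I_n => p.1 != p.2)
    (fun p => `|alpha p.1 - alpha p.2|).

Definition constB : R :=
  fin_min xpredT (fun i : 'I_n => \prod_(j < n | j != i) `|alpha j - alpha i|).

Definition constC : R :=
  Num.max (K / ((1 - eps) ^+ (n - 1) * constB)) 1.

Definition constC1 : R :=
  Num.max (K `^ (n%:R)^-1 / (eps * constA))
          ((2 * constC) `^ ((n - 2)%:R)^-1).

Definition constC2 : R :=
  Num.max (K `^ (n%:R)^-1 / (eps * constA))
          (constC `^ ((n - 2)%:R)^-1).

Definition constD : R :=
  (K / (eta * (1 - eps) ^+ (n - 1) * constA * constB)) `^ (n%:R)^-1.

Definition constE : R :=
  (1 + eta) ^+ (n - 1) * K / (1 - eps) ^+ (n - 1).

End Constants.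

Section QuadraticField.
Variables (R : realType) (m : nat).

Definition i_sqrt : R[i] := 'i%C * (Num.sqrt (m%:R : R))%:C.

(* Q(i sqrt m), as the smallest subfield of R[i] containing i sqrt m. *)
Definition in_quadratic_field (z : R[i]) : Prop :=
  forall S : {pred R[i]}, GRing.divring_closed S -> i_sqrt \in S -> z \in S.

Definition in_ring_of_integers (z : R[i]) : Prop :=
  in_quadratic_field z /\ integralOver (intr : int -> R[i]) z.

End QuadraticField.

(* Main.v *)
(* Write F(x, y) as the product of the x - alpha_j y and let alpha_i be the root
   for which |x - alpha_i y| is least, so that it is at most K^(1/n). As |y| is
   large, |x - alpha_j y| >= (1 - eps) |alpha_j - alpha_i| |y| for j <> i, whence
   |x - alpha_i y| <= K / ((1 - eps)^(n-1) B_i |y|^(n-1)), where B_i is the product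
   of the |alpha_j - alpha_i|. Since alpha_i is real, the imaginary part of
   x * conj y, an integer multiple of sqrt m or sqrt m / 2, is at most
   C |y|^(2-n) in absolute value, so it vanishes: x / y is real. It is then the
   ratio a / b of the real parts and of the imaginary parts of x and y, and
   |a - alpha_i b| <= |x - alpha_i y| since |b| <= |y|. If |b| >= D this gives
   |a - alpha_j b| <= (1 + eta) |alpha_j - alpha_i| |b| for j <> i, hence
   |F(a, b)| <= E; the factors B_i cancel. *)

Require Import Defs.
From HB Require Import structures.
From mathcomp Require Import all_boot all_order all_algebra.
From mathcomp Require Import reals exp.
From mathcomp Require Import complex.
From mathcomp Require Import mpoly.
From mathcomp Require Import ring lra.

Set Implicit Arguments.
Unset Strict Implicit.
Unset Printing Implicit Defensive.

Import Order.TTheory GRing.Theory Num.Theory.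
Local Open Scope ring_scope.
Local Open Scope complex_scope.

(** * Evaluation and factorization of binary forms *)

Lemma form_evalE (S : comNzRingType) (F : {mpoly int[2]}) (x y : S) :
  form_eval F x y =
  \sum_(k <- msupp F) (F@_k)%:~R * (x ^+ k ord0 * y ^+ k ord_max).
Proof.
rewrite /form_eval /mmap; apply: eq_bigr => k _.
by rewrite /mmap1 big_ord_recl big_ord1 (_ : lift ord0 ord0 = ord_max) //;
  apply: val_inj.
Qed.

Lemma rmorph_form_eval (S S' : comNzRingType) (f : {rmorphism S -> S'})
    (F : {mpoly int[2]}) (x y : S) :
  f (form_eval F x y) = form_eval F (f x) (f y).
Proof.
rewrite !form_evalE rmorph_sum; apply: eq_bigr => k _.
by rewrite !rmorphM /= rmorph_int !rmorphXn.
Qed.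

Lemma binary_form_mdeg (n : nat) (F : {mpoly int[2]}) (k : 'X_{1..2}) :
  binary_form n F -> k \in msupp F -> (k ord0 + k ord_max = n)%N.
Proof.
move=> /dhomogP homF /homF <-.
rewrite /= mdegE big_ord_recl big_ord1; congr (_ + k _)%N; exact: val_inj.
Qed.

Lemma form_evalZ (S : comNzRingType) (n : nat) (F : {mpoly int[2]}) (t x y : S) :
  binary_form n F -> form_eval F (t * x) (t * y) = t ^+ n * form_eval F x y.
Proof.
move=> homF; rewrite !form_evalE big_distrr !big_seq; apply: eq_bigr => k kF /=.
rewrite -(binary_form_mdeg homF kF) exprD !exprMn; ring.
Qed.

Lemma horner_dehomogenize (S : comNzRingType) (F : {mpoly int[2]}) (x : S) :
  (map_poly intr (dehomogenize F)).[x] = form_eval F x 1.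
Proof.
(* Evaluation at [x] after mapping coefficients is a ring morphism from [{poly int}] to [S], so it
   commutes with [form_eval] and sends ['X] to [x]. *)
rewrite /dehomogenize -[LHS]/((horner_eval x \o map_poly intr) _).
rewrite rmorph_form_eval /= rmorph1 map_polyX /horner_eval hornerX hornerC //.
Qed.

Lemma size_dehomogenize (n : nat) (F : {mpoly int[2]}) :
  binary_form n F -> (size (dehomogenize F) <= n.+1)%N.
Proof.
move=> homF; rewrite /dehomogenize form_evalE big_seq.
apply: (leq_trans (size_sum _ _ _)); apply/bigmax_leqP_seq => k kF _.
rewrite expr1n mulr1 -mulrzl mulr1 mulrzl -scaler_int.
apply: (leq_trans (size_scale_leq _ _)).
by rewrite size_polyXn ltnS -(binary_form_mdeg homF kF) leq_addr.
Qed.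

(** Homogeneity bounds the degree of f by n, and the n distinct roots bound it below, so the monic f
    is the product of the X - alpha_i. Then F(x, y) = y^n f(x / y), whence [y != 0]. The field is
    arbitrary because both [R] and [R[i]] are needed. *)
Lemma form_eval_prod (S : fieldType) (n : nat) (F : {mpoly int[2]})
    (alpha : 'I_n -> S) (x y : S) :
  binary_form n F -> dehomogenize F \is monic -> injective alpha ->
  (forall i, root (map_poly intr (dehomogenize F)) (alpha i)) -> y != 0 ->
  form_eval F x y = \prod_i (x - alpha i * y).
Proof.
move=> homF f_monic alpha_inj alpha_root y0.
set f := map_poly _ _ in alpha_root.
have f_mon : f \is monic by apply: monic_map.
pose rs := [seq alpha i | i <- enum 'I_n].
have rs_root : all (root f) rs by apply/allP => _ /mapP[i _ ->].
have rs_uniq : uniq rs by rewrite map_inj_uniq ?enum_uniq.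
have size_rs : size rs = n by rewrite size_map size_enum_ord.
have size_f : size f = (size rs).+1.
  apply/eqP; rewrite eqn_leq (max_poly_roots (monic_neq0 f_mon)) // andbT size_rs.
  exact: leq_trans (size_poly _ _) (size_dehomogenize homF).
have fE := all_roots_prod_XsubC size_f rs_root.
rewrite uniq_rootsE (monicP f_mon) scale1r in fE.
have -> : form_eval F x y = form_eval F (y * (x / y)) (y * 1).
  by rewrite mulr1 mulrC divfK.
rewrite (form_evalZ _ _ _ homF) -horner_dehomogenize -/f fE //.
rewrite horner_prod big_map big_enum /= -{1}(card_ord n) -prodr_const -big_split /=.
by apply: eq_bigr => i _; rewrite !hornerE; field.
Qed.

(** * The minima A and B *)

Lemma fin_min_le (R : realType) (I : finType) (P : pred I) (g : I -> R) (i : I) :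
  P i -> fin_min P g <= g i.
Proof.
rewrite /fin_min => Pi; case: pickP => [i0 Pi0|/(_ i)]; last by rewrite Pi.
by case: arg_minP => // k _ ->.
Qed.

Lemma fin_min_gt0 (R : realType) (I : finType) (P : pred I) (g : I -> R) (i : I) :
  P i -> (forall j, P j -> 0 < g j) -> 0 < fin_min P g.
Proof.
rewrite /fin_min => Pi g_gt0; case: pickP => [i0 Pi0|/(_ i)]; last by rewrite Pi.
by case: arg_minP => // k Pk _; exact: g_gt0.
Qed.

Lemma constA_le (R : realType) (n : nat) (alpha : 'I_n -> R) (i j : 'I_n) :
  j != i -> constA alpha <= `|alpha j - alpha i|.
Proof. by move=> ji; apply: (@fin_min_le _ _ _ _ (j, i)). Qed.

(** As n > 1 there are two distinct indices, so the default value 0 of [fin_min] is not taken. *)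
Lemma constA_gt0 (R : realType) (n : nat) (alpha : 'I_n -> R) :
  (1 < n)%N -> injective alpha -> 0 < constA alpha.
Proof.
case: n alpha => [|[|n]] // alpha _ alpha_inj.
apply: (@fin_min_gt0 _ _ _ _ (ord0, ord_max)) => // -[i j] /= ij.
by rewrite normr_gt0 subr_eq0 (inj_eq alpha_inj).
Qed.

Lemma prod_dist_gt0 (R : realType) (n : nat) (alpha : 'I_n -> R) (i : 'I_n) :
  injective alpha -> 0 < \prod_(j < n | j != i) `|alpha j - alpha i|.
Proof.
move=> alpha_inj; apply: prodr_gt0 => j ji.
by rewrite normr_gt0 subr_eq0 (inj_eq alpha_inj).
Qed.

Lemma constB_le (R : realType) (n : nat) (alpha : 'I_n -> R) (i : 'I_n) :
  constB alpha <= \prod_(j < n | j != i) `|alpha j - alpha i|.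
Proof. exact: fin_min_le. Qed.

Lemma constB_gt0 (R : realType) (n : nat) (alpha : 'I_n -> R) :
  (0 < n)%N -> injective alpha -> 0 < constB alpha.
Proof.
case: n alpha => // n alpha _ alpha_inj.
by apply: (@fin_min_gt0 _ _ _ _ ord0) => // j _; exact: prod_dist_gt0.
Qed.

Lemma powR_invn_expn (R : realType) (a : R) (n : nat) :
  0 <= a -> (0 < n)%N -> (a `^ n%:R^-1) ^+ n = a.
Proof.
move=> a0 n0; rewrite -powR_mulrn ?powR_ge0 // -powRrM mulVf ?powRr1 //.
by rewrite pnatr_eq0 -lt0n.
Qed.

(** * Real estimates near a root *)

Lemma prod_scaled_dist (R : realType) (n : nat) (alpha : 'I_n -> R) (i : 'I_n)
    (c : R) :
  \prod_(j < n | j != i) (c * `|alpha j - alpha i|) =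
  c ^+ (n - 1) * \prod_(j < n | j != i) `|alpha j - alpha i|.
Proof. by rewrite prodrMl cardC1 card_ord subn1. Qed.

(** Here b_i stands for |x - alpha_i y| and N for |y|; the complex numbers enter only through the
    triangle inequality. The product B_i is kept instead of its lower bound B, so that it can cancel
    in [prod_linear_le_constE]. *)
Lemma near_root (R : realType) (n : nat) (alpha b : 'I_n -> R) (eps K N : R) :
  (1 < n)%N -> injective alpha -> 0 < eps < 1 -> 0 <= K ->
  (forall i, 0 <= b i) ->
  (forall i j, `|alpha j - alpha i| * N <= b i + b j) ->
  \prod_i b i <= K ->
  K `^ n%:R^-1 / (eps * constA alpha) < N ->
  exists i, b i * ((1 - eps) ^+ (n - 1)
     * (\prod_(j < n | j != i) `|alpha j - alpha i|) * N ^+ (n - 1)) <= K.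
Proof.
move=> n1 alpha_inj /andP[eps0 eps1] K0 b0 b_dist b_K N_big.
have n0 : (0 < n)%N by exact: ltnW.
have A0 := constA_gt0 n1 alpha_inj.
have N0 : 0 <= N by rewrite (le_trans _ (ltW N_big)) // divr_ge0 ?powR_ge0 // mulr_ge0 // ltW.
pose i0 : 'I_n := Ordinal n0.
have [i b_min] : exists i, forall j, b i <= b j.
  by exists [arg min_(i < i0) b i]%O; case: arg_minP => // i _ bi j; exact: bi.
exists i.
have bi_K : b i <= K `^ n%:R^-1.
  rewrite -(@ler_pXn2r _ n) ?nnegrE ?powR_ge0 // powR_invn_expn //.
  apply: le_trans b_K; rewrite -{1}(card_ord n) -prodr_const.
  by apply: ler_prod => j _; rewrite b0 b_min.
have bi_A : b i <= eps * constA alpha * N.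
  apply: (le_trans bi_K); rewrite mulrC -ler_pdivrMr ?mulr_gt0 //; exact: ltW.
apply: le_trans b_K; rewrite [leRHS](bigD1 i) //= ler_wpM2l //.
rewrite mulrAC -exprMn -prod_scaled_dist; apply: ler_prod => j ji.
rewrite !mulr_ge0 ?subr_ge0 ?(ltW eps1) //=.
(* With d = |alpha_j - alpha_i|: b_i <= eps A N <= eps d N and d N <= b_i + b_j, so b_j >= (1 - eps)
   d N. *)
have := b_dist i j; have := ler_wpM2r N0 (ler_wpM2l (ltW eps0) (constA_le alpha ji)).
by lra.
Qed.

(** The last hypothesis serves twice: with |b| >= D it shows that a / b is within eta A of alpha_i,
    which bounds the other factors by (1 + eta) |alpha_j - alpha_i| |b|; then it bounds the
    resulting product, in which B_i and |b|^(n-1) appear again. *)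
Lemma prod_linear_le_constE (R : realType) (n : nat) (alpha : 'I_n -> R)
    (eps eta K a b : R) (i : 'I_n) :
  (1 < n)%N -> injective alpha -> 0 < eps < 1 -> 0 < eta < 1 -> 0 < K ->
  constD alpha eps eta K <= `|b| ->
  `|a - alpha i * b| * ((1 - eps) ^+ (n - 1)
     * (\prod_(j < n | j != i) `|alpha j - alpha i|) * `|b| ^+ (n - 1)) <= K ->
  \prod_j `|a - alpha j * b| <= constE n eps eta K.
Proof.
move=> n1 alpha_inj /andP[eps0 eps1] /andP[eta0 eta1] K0 D_b near.
have n0 : (0 < n)%N by exact: ltnW.
have A0 := constA_gt0 n1 alpha_inj; have B0 := constB_gt0 n0 alpha_inj.
have Bi := constB_le alpha i; have Bi0 := prod_dist_gt0 i alpha_inj.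
have e0 : 0 < (1 - eps) ^+ (n - 1) by rewrite exprn_gt0 // subr_gt0.
set B_i := \prod_(j < n | j != i) _ in near Bi Bi0.
set e := (1 - eps) ^+ (n - 1) in near e0; set g := `|a - _| in near.
have den0 : 0 < eta * e * constA alpha * constB alpha by rewrite !mulr_gt0.
have b_gt0 : 0 < `|b|.
  by apply: lt_le_trans D_b; rewrite powR_gt0 // divr_gt0.
have K_b : K <= eta * e * constA alpha * constB alpha * `|b| ^+ n.
  rewrite mulrC -ler_pdivrMr // -(@powR_invn_expn _ (K / _) n) //; last first.
    by rewrite divr_ge0 // ltW.
  by rewrite ler_pXn2r ?nnegrE ?powR_ge0.
have bp0 : 0 < `|b| ^+ (n - 1) by rewrite exprn_gt0.
have g_A : g <= eta * constA alpha * `|b|.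
  have t0 : 0 < e * B_i * `|b| ^+ (n - 1) by rewrite !mulr_gt0.
  (* After multiplication by (1 - eps)^(n-1) B_i |b|^(n-1), what remains is B <= B_i. *)
  rewrite -(ler_pM2r t0); apply: (le_trans near); apply: (le_trans K_b).
  rewrite -[X in _ ^+ X](subnK n0) addn1 exprSr.
  have -> : eta * constA alpha * `|b| * (e * B_i * `|b| ^+ (n - 1)) =
    eta * e * constA alpha * B_i * (`|b| ^+ (n - 1) * `|b|) by ring.
  by rewrite ler_wpM2r ?mulr_ge0 ?(ltW bp0) // ler_wpM2l // !mulr_ge0 // ltW.
rewrite (bigD1 i) //= -/g.
have far : \prod_(j < n | j != i) `|a - alpha j * b| <=
    ((1 + eta) * `|b|) ^+ (n - 1) * B_i.
  rewrite -prod_scaled_dist; apply: ler_prod => j ji; rewrite normr_ge0 /=.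
  have -> : a - alpha j * b = (a - alpha i * b) - (alpha j - alpha i) * b by ring.
  apply: (le_trans (ler_normB _ _)); rewrite -/g normrM.
  have := ler_wpM2r (ltW b_gt0) (ler_wpM2l (ltW eta0) (constA_le alpha ji)).
  by lra.
apply: (le_trans (ler_wpM2l (normr_ge0 _) far)).
rewrite /constE -/e ler_pdivlMr // exprMn.
have -> : g * ((1 + eta) ^+ (n - 1) * `|b| ^+ (n - 1) * B_i) * e =
  (1 + eta) ^+ (n - 1) * (g * (e * B_i * `|b| ^+ (n - 1))) by ring.
by rewrite ler_wpM2l // exprn_ge0 // addr_ge0 // ltW.
Qed.

(** * The complex modulus as a real number *)

Local Notation normc := ComplexField.Normc.normc.

(** The norm of [R[i]] takes its values in [R[i]]; this moves inequalities to the ordered field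
    [R]. *)
Lemma normc_normr (R : rcfType) (z : R[i]) : `|z| = (normc z)%:C.
Proof. by []. Qed.

Lemma normc_ge0 (R : rcfType) (z : R[i]) : 0 <= normc z.
Proof. by case: z => a b; exact: sqrtr_ge0. Qed.

Lemma normc_real (R : rcfType) (a : R) : normc a%:C = `|a|.
Proof. by rewrite /normc /= expr0n addr0 sqrtr_sqr. Qed.

Lemma normr_Re_le (R : rcfType) (a b : R) : `|a| <= normc (a +i* b).
Proof. by rewrite -sqrtr_sqr ler_wsqrtr // lerDl sqr_ge0. Qed.

Lemma normr_Im_le (R : rcfType) (a b : R) : `|b| <= normc (a +i* b).
Proof. by rewrite -sqrtr_sqr ler_wsqrtr // lerDr sqr_ge0. Qed.

Lemma ler_normcB (R : rcfType) (z w : R[i]) : normc (z - w) <= normc z + normc w.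
Proof. by have := ler_normB z w; rewrite !normc_normr -rmorphD lecR. Qed.

Lemma normc_prod (R : rcfType) (n : nat) (z : 'I_n -> R[i]) :
  normc (\prod_i z i) = \prod_i normc (z i).
Proof.
apply: (@complexI R); rewrite -normc_normr normr_prod rmorph_prod.
exact: eq_bigr.
Qed.

Lemma root_complex (R : rcfType) (p : {poly int}) (a : R) :
  root (map_poly intr p) a -> root (map_poly intr p) a%:C.
Proof.
move=> pa; have : root (map_poly (real_complex R) (map_poly intr p)) a%:C.
  by rewrite rmorph_root.
by rewrite -map_poly_comp (eq_map_poly (g := intr)) // => k /=; rewrite rmorph_int.
Qed.

(** * Small values of the form at complex arguments *)

Section SmallValues.
Variables (R : realType) (n : nat) (F : {mpoly int[2]}).
Variables (alpha : 'I_n -> R) (eps eta K : R).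
Hypotheses (n_ge3 : (3 <= n)%N) (F_form : binary_form n F).
Hypotheses (f_monic : dehomogenize F \is monic) (alpha_inj : injective alpha).
Hypothesis alpha_root : forall i : 'I_n,
  root (map_poly (intr : int -> R) (dehomogenize F)) (alpha i).
Hypotheses (eps_bounds : 0 < eps < 1) (eta_bounds : 0 < eta < 1).
Hypothesis K_ge1 : 1 <= K.

Lemma form_near_root (x y : R[i]) :
  y != 0 -> `|form_eval F x y| <= K%:C ->
  K `^ n%:R^-1 / (eps * constA alpha) < normc y ->
  exists i, normc (x - (alpha i)%:C * y) * ((1 - eps) ^+ (n - 1)
    * (\prod_(j < n | j != i) `|alpha j - alpha i|) * normc y ^+ (n - 1)) <= K.
Proof.
move=> y0 F_le y_big.
apply: (near_root (b := fun i => normc (x - (alpha i)%:C * y))) => //.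
- exact: ltnW.
- exact: le_trans ler01 K_ge1.
- by move=> i; exact: normc_ge0.
- move=> i j; rewrite -normc_real -ComplexField.Normc.normcM rmorphB /=.
  apply: le_trans (ler_normcB _ _); rewrite le_eqVlt; apply/orP; left.
  (* (alpha_j - alpha_i) y = (x - alpha_i y) - (x - alpha_j y). *)
  by apply/eqP; congr normc; ring.
- rewrite -normc_prod -lecR -normc_normr.
  rewrite -(form_eval_prod x F_form f_monic (alpha := fun i => (alpha i)%:C)) //.
    by move=> i j /complexI /alpha_inj.
  by move=> i; exact: root_complex.
Qed.

(* The imaginary parts of [x * y^*] and [(x - alpha_i * y) * y^*] agree because
   [alpha_i] is real. *)
Lemma small_cross_product (u u' v v' : R) :
  v +i* v' != 0 -> `|form_eval F (u +i* u') (v +i* v')| <= K%:C ->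
  K `^ n%:R^-1 / (eps * constA alpha) < normc (v +i* v') ->
  `|u' * v - u * v'| * normc (v +i* v') ^+ (n - 2) <= constC alpha eps K.
Proof.
move=> y0 F_le y_big; have [i near] := form_near_root y0 F_le y_big.
set y := v +i* v' in y0 F_le y_big near *.
set z : R[i] := u +i* u' - _ in near.
have cross : `|u' * v - u * v'| <= normc z * normc y.
  have -> : u' * v - u * v' =
    complex.Re z * (- v') + complex.Im z * v by rewrite /z /y /=; ring.
  have -> : normc y = normc (v +i* (- v')) by rewrite /y /= sqrrN.
  rewrite -ComplexField.Normc.normcM; case: (z) => c d /=.
  exact: (normr_Im_le (c * v - d * - v') (c * - v' + d * v)).
have N0 : 0 <= normc y := normc_ge0 y.
have n0 : (0 < n)%N by exact: leq_trans n_ge3.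
have B0 := constB_gt0 n0 alpha_inj; have Bi := constB_le alpha i.
have /andP[eps0 eps1] := eps_bounds.
have e0 : 0 < (1 - eps) ^+ (n - 1) by rewrite exprn_gt0 // subr_gt0.
rewrite le_max; apply/orP; left; rewrite ler_pdivlMr ?mulr_gt0 //.
apply: le_trans near.
set e := (1 - eps) ^+ _ in e0 *.
(* One of the n - 1 factors |y| joins |z| to dominate the cross product; n - 2 are left. *)
have -> : (n - 1 = (n - 2).+1)%N by rewrite -subSn 1?ltnW.
rewrite exprS.
set P := normc y ^+ _.
have P0 : 0 <= P by rewrite exprn_ge0.
have -> : normc z * (e * (\prod_(j < n | j != i) `|alpha j - alpha i|)
    * (normc y * P)) = normc z * normc y * P *
    (e * \prod_(j < n | j != i) `|alpha j - alpha i|) by ring.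
apply: ler_pM; rewrite ?mulr_ge0 ?normr_ge0 ?(ltW B0) ?(ltW e0) //.
  by rewrite ler_wpM2r.
by rewrite ler_wpM2l // ltW.
Qed.

(** From a y = b x follows (a - alpha_i b) y = b (x - alpha_i y), so |b| <= |y| makes the estimate
    of [form_near_root] descend from (x, y) to (a, b). The pair (a, b) will be the real parts or the
    imaginary parts of x and y. *)
Lemma form_real_ratio (x y : R[i]) (a b : R) :
  y != 0 -> `|form_eval F x y| <= K%:C ->
  K `^ n%:R^-1 / (eps * constA alpha) < normc y ->
  a%:C * y = b%:C * x -> `|b| <= normc y -> constD alpha eps eta K <= `|b| ->
  `|form_eval F a b| <= constE n eps eta K.
Proof.
move=> y0 F_le y_big ratio b_y D_b.
have [i near] := form_near_root y0 F_le y_big.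
have n1 : (1 < n)%N by exact: ltnW.
have n0 : (0 < n)%N by exact: leq_trans n_ge3.
have K0 : 0 < K by apply: lt_le_trans K_ge1.
have /andP[eps0 eps1] := eps_bounds; have /andP[eta0 eta1] := eta_bounds.
have e0 : 0 < (1 - eps) ^+ (n - 1) by rewrite exprn_gt0 // subr_gt0.
(* D is positive. *)
have b0 : b != 0.
  rewrite -normr_gt0; apply: lt_le_trans D_b; rewrite powR_gt0 // divr_gt0 //.
  by rewrite !mulr_gt0 // ?constA_gt0 // constB_gt0.
rewrite (form_eval_prod a F_form f_monic alpha_inj alpha_root b0) normr_prod.
apply: (prod_linear_le_constE (i := i) n1) => //.
have N0 : 0 < normc y by apply: lt_le_trans b_y; rewrite normr_gt0.
have dist : `|a - alpha i * b| <= normc (x - (alpha i)%:C * y).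
  rewrite -(ler_pM2r N0) -normc_real -ComplexField.Normc.normcM.
  have -> : (a - alpha i * b)%:C * y = b%:C * (x - (alpha i)%:C * y).
    by rewrite rmorphB rmorphM /= mulrBl ratio; ring.
  by rewrite ComplexField.Normc.normcM normc_real mulrC ler_wpM2l // normc_ge0.
apply: le_trans near; have B0 := ltW (prod_dist_gt0 i alpha_inj).
apply: ler_pM; rewrite ?mulr_ge0 ?(ltW e0) ?exprn_ge0 ?normr_ge0 //.
by rewrite ler_wpM2l ?mulr_ge0 ?(ltW e0) // lerXn2r // nnegrE ltW.
Qed.

Lemma small_value_coordinates (u u' v v' : R) :
  v +i* v' != 0 -> `|form_eval F (u +i* u') (v +i* v')| <= K%:C ->
  K `^ n%:R^-1 / (eps * constA alpha) < normc (v +i* v') -> u' * v = u * v' ->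
  [/\ v = 0 -> u = 0 /\ `|form_eval F u' v'| <= K,
      constD alpha eps eta K <= `|v| -> `|form_eval F u v| <= constE n eps eta K,
      v' = 0 -> u' = 0 /\ `|form_eval F u v| <= K
    & constD alpha eps eta K <= `|v'| ->
      `|form_eval F u' v'| <= constE n eps eta K].
Proof.
move=> y0 F_le y_big cross; split.
- move=> v0; rewrite v0 in y0 F_le cross.
  have v'0 : v' != 0 by apply: contraNneq y0 => ->.
  have u0 : u = 0 by apply: (mulIf v'0); rewrite -cross mulr0 mul0r.
  split=> //; move: F_le; rewrite u0.
  (* Both arguments are purely imaginary, so homogeneity takes out i^n, of modulus 1. *)
  have zE (t : R) : 0 +i* t = 'i%C * t%:C by simpc.
  rewrite (zE u') (zE v') (form_evalZ _ _ _ F_form) -rmorph_form_eval normrM normrX.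
  have -> : `|'i%C| = 1 :> R[i] by rewrite normc_normr /= expr0n add0r expr1n sqrtr1.
  by rewrite expr1n mul1r normc_normr normc_real lecR.
- move=> D_v; apply: form_real_ratio y0 F_le y_big _ _ D_v; last exact: normr_Re_le.
  by apply/eqP; rewrite eq_complex /=; apply/andP; split; apply/eqP; lra.
- move=> v0; rewrite v0 in y0 F_le cross.
  have v'0 : v != 0 by apply: contraNneq y0 => ->.
  have u0 : u' = 0 by apply: (mulIf v'0); rewrite cross mulr0 mul0r.
  split=> //; move: F_le; rewrite u0 -[u +i* 0]/(u%:C) -[v +i* 0]/(v%:C).
  by rewrite -rmorph_form_eval normc_normr normc_real lecR.
- move=> D_v; apply: form_real_ratio y0 F_le y_big _ _ D_v; last exact: normr_Im_le.
  by apply/eqP; rewrite eq_complex /=; apply/andP; split; apply/eqP; lra.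
Qed.

(** * Integer coordinates *)

Lemma form_eval_scaled_norm (s : R) (a b : int) :
  0 < s -> `|form_eval F (s * a%:~R) (s * b%:~R)| =
           `|form_eval F a b|%:~R * s ^+ n.
Proof.
move=> s0; rewrite (form_evalZ _ _ _ F_form) -rmorph_form_eval.
by rewrite normrM normrX (gtr0_norm s0) mulrC intr_norm.
Qed.

(** Covers both shapes of the integral basis: (s, s') is (1/2, sqrt m / 2) for m = 3 mod 4, where a
    = 2 x_1 + x_2 and b = 2 y_1 + y_2, and (1, sqrt m) otherwise. Homogeneity turns the scales into
    the factors s^n and s'^n. *)
Lemma small_value_integers (s s' : R) (a a' b b' : int) (x y : R[i]) :
  0 < s -> 0 < s' ->
  x = (s * a%:~R) +i* (s' * a'%:~R) -> y = (s * b%:~R) +i* (s' * b'%:~R) ->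
  y != 0 -> `|form_eval F x y| <= K%:C ->
  K `^ n%:R^-1 / (eps * constA alpha) < normc y -> a' * b = a * b' ->
  [/\ b = 0 -> a = 0 /\ `|form_eval F a' b'|%:~R <= K / s' ^+ n,
      constD alpha eps eta K / s <= `|b|%:~R ->
        `|form_eval F a b|%:~R <= constE n eps eta K / s ^+ n,
      b' = 0 -> a' = 0 /\ `|form_eval F a b|%:~R <= K / s ^+ n
    & constD alpha eps eta K / s' <= `|b'|%:~R ->
      `|form_eval F a' b'|%:~R <= constE n eps eta K / s' ^+ n].
Proof.
move=> s0 s'0 -> -> y0 F_le y_big cross.
have sn0 (t : R) : 0 < t -> 0 < t ^+ n by move=> ?; rewrite exprn_gt0.
have norm_scaled (t : R) (c : int) :
    0 < t -> `|t * c%:~R| = `|c|%:~R * t.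
  by move=> t0; rewrite normrM (gtr0_norm t0) intr_norm mulrC.
have scaled0 (t : R) (c : int) : 0 < t -> t * c%:~R = 0 -> c = 0.
  by move=> t0 /eqP; rewrite mulf_eq0 (gt_eqF t0) intr_eq0 => /eqP.
have [] := small_value_coordinates y0 F_le y_big.
  have := congr1 (intr : int -> R) cross; rewrite !intrM => crossR.
  by rewrite mulrACA crossR; ring.
rewrite !form_eval_scaled_norm // !norm_scaled // => h1 h2 h3 h4; split.
- move=> b0; have [|a0 ?] := h1; first by rewrite b0 mulr0.
  by split; [exact: scaled0 a0 | rewrite ler_pdivlMr ?sn0].
- by rewrite ler_pdivrMr // ler_pdivlMr ?sn0.
- move=> b0; have [|a0 ?] := h3; first by rewrite b0 mulr0.
  by split; [exact: scaled0 a0 | rewrite ler_pdivlMr ?sn0].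
- by rewrite ler_pdivrMr // ler_pdivlMr ?sn0.
Qed.

Lemma constC_gt0 : 0 < constC alpha eps K.
Proof. by rewrite lt_max ltr01 orbT. Qed.

(** If k were nonzero, the cross product would be at least s in absolute value, so c C >= c s
    |y|^(n-2) >= |y|^(n-2), against the lower bound on |y|. The factor c is 2 for C_1 and 1 for
    C_2. *)
Lemma cross_product_eq0 (x y : R[i]) (u u' v v' c s : R) (k : int) :
  x = u +i* u' -> y = v +i* v' -> y != 0 -> `|form_eval F x y| <= K%:C ->
  K `^ n%:R^-1 / (eps * constA alpha) < normc y ->
  0 < c -> (c * constC alpha eps K) `^ (n - 2)%:R^-1 < normc y ->
  u' * v - u * v' = s * k%:~R -> 1 <= c * s -> k = 0.
Proof.
move=> -> -> y0 F_le y_big c0 y_bigC kE cs.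
have := small_cross_product y0 F_le y_big; rewrite kE.
set N := normc _ in y_bigC * => small.
have N0 : 0 < N by apply: le_lt_trans y_bigC; exact: powR_ge0.
have n2 : (0 < n - 2)%N by rewrite subn_gt0.
have C_N : c * constC alpha eps K < N ^+ (n - 2).
  have cC0 : 0 <= c * constC alpha eps K by rewrite mulr_ge0 ?ltW ?constC_gt0.
  by rewrite -[ltLHS](powR_invn_expn cC0 n2) ltr_pXn2r ?nnegrE ?powR_ge0 // ltW.
apply: contraTeq C_N => k0; rewrite -leNgt.
apply: le_trans (ler_wpM2l (ltW c0) small).
have s0 : 0 < s by rewrite -(pmulr_rgt0 _ c0) (lt_le_trans ltr01).
rewrite mulrA ler_peMl ?exprn_ge0 ?(ltW N0) // normrM (gtr0_norm s0) mulrA.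
rewrite (le_trans cs) // ler_peMr ?mulr_ge0 ?(ltW c0) ?(ltW s0) //.
(* A nonzero integer has absolute value at least 1. *)
by rewrite -intr_norm ler1z -gtz0_ge1 normr_gt0.
Qed.

End SmallValues.

(** * The two integral bases *)

Theorem theorem1 (R : realType) (n : nat) (F : {mpoly int[2]})
  (alpha : 'I_n -> R) (eps eta K : R) (m : nat)
  (x y : R[i]) (x1 x2 y1 y2 : int)
  (n_ge3 : (3 <= n)%N)
  (F_form : binary_form n F)
  (f_monic : dehomogenize F \is monic)
  (alpha_inj : injective alpha)
  (alpha_root : forall i : 'I_n,
     root (map_poly (intr : int -> R) (dehomogenize F)) (alpha i))
  (eps_bounds : 0 < eps < 1)
  (eta_bounds : 0 < eta < 1)
  (K_ge1 : 1 <= K)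
  (m_gt1 : (1 < m)%N)
  (m_sqfree : squarefree m)
  (x_int : in_ring_of_integers m x)
  (y_int : in_ring_of_integers m y)
  (F_le : `|form_eval F x y| <= K%:C)
  (coord3 : m = 3 %[mod 4] ->
     x = x1%:~R + x2%:~R * ((1 + i_sqrt R m) / 2) /\
     y = y1%:~R + y2%:~R * ((1 + i_sqrt R m) / 2))
  (coord12 : m = 1 %[mod 4] \/ m = 2 %[mod 4] ->
     x = x1%:~R + x2%:~R * i_sqrt R m /\
     y = y1%:~R + y2%:~R * i_sqrt R m)
  (y_big3 : m = 3 %[mod 4] -> (constC1 alpha eps K)%:C < `|y|)
  (y_big12 : m = 1 %[mod 4] \/ m = 2 %[mod 4] ->
     (constC2 alpha eps K)%:C < `|y|) :
  let D := constD alpha eps eta K in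
  let E := constE n eps eta K in
  let sm : R := Num.sqrt m%:R in
  let absF (a b : int) : R := `|form_eval F a b|%:~R in
  x2 * y1 = x1 * y2 /\
  (m = 3 %[mod 4] ->
     [/\ 2 * y1 + y2 = 0 ->
           2 * x1 + x2 = 0 /\ absF x2 y2 <= 2 ^+ n * K / sm ^+ n,
         2 * D <= `|2 * y1 + y2|%:~R ->
           absF (2 * x1 + x2) (2 * y1 + y2) <= 2 ^+ n * E,
         y2 = 0 ->
           x2 = 0 /\ absF x1 y1 <= K
       & 2 / sm * D <= `|y2|%:~R ->
           absF x2 y2 <= 2 ^+ n / sm ^+ n * E]) /\
  (m = 1 %[mod 4] \/ m = 2 %[mod 4] ->
     [/\ y1 = 0 ->
           x1 = 0 /\ absF x2 y2 <= K / sm ^+ n,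
         D <= `|y1|%:~R ->
           absF x1 y1 <= E,
         y2 = 0 ->
           x2 = 0 /\ absF x1 y1 <= K
       & D / sm <= `|y2|%:~R ->
           absF x2 y2 <= E / sm ^+ n]).
Proof.
move=> D E sm absF.
have sm1 : 1 < sm.
  by rewrite -(sqrtr1 R) /sm ltr_sqrt ?ltr1n // ltr0n ltnW.
have sm0 : 0 < sm := lt_trans ltr01 sm1.
have nz (C : R) : 0 <= C -> C%:C < `|y| -> y != 0.
  by move=> C0 Cy; rewrite -normr_gt0 (le_lt_trans _ Cy) // lecR.
(* C_1 and C_2 both have this shape, so either bound on |y| forces y to be nonzero. *)
have max_ge0 (a b : R) : 0 <= Num.max a (b `^ (n - 2)%:R^-1).
  by rewrite le_max powR_ge0 orbT.
have Ci : i_sqrt R m = 'i%C * sm%:C by [].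
have m_cases : [\/ m = 3 %[mod 4], m = 1 %[mod 4] | m = 2 %[mod 4]].
  have := ltn_pmod m (isT : 0 < 4)%N; case E4 : (m %% 4)%N => [|[|[|[|?]]]] // _.
  (* Residue 0 contradicts squarefreeness at d = 2. *)
  - have : (2 ^ 2 %| m)%N by rewrite /dvdn E4.
    by move/m_sqfree.
  - exact: Or32.
  - exact: Or33.
  - exact: Or31.
have case3 : m = 3 %[mod 4] -> x2 * y1 = x1 * y2 /\
    [/\ 2 * y1 + y2 = 0 ->
           2 * x1 + x2 = 0 /\ absF x2 y2 <= 2 ^+ n * K / sm ^+ n,
         2 * D <= `|2 * y1 + y2|%:~R ->
           absF (2 * x1 + x2) (2 * y1 + y2) <= 2 ^+ n * E,
         y2 = 0 ->
           x2 = 0 /\ absF x1 y1 <= K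
       & 2 / sm * D <= `|y2|%:~R ->
           absF x2 y2 <= 2 ^+ n / sm ^+ n * E].
  move=> m3; have [xE yE] := coord3 m3; have y_big := y_big3 m3.
  have y0 := nz _ (max_ge0 _ _) y_big.
  move: y_big; rewrite normc_normr ltcR gt_max => /andP[y_bigA y_bigC].
  have coordE (a b : int) : a%:~R + b%:~R * ((1 + i_sqrt R m) / 2) =
      (2^-1 * (2 * a + b)%:~R) +i* (sm / 2 * b%:~R) :> R[i].
    rewrite [RHS]complexE /= Ci !(rmorphM, rmorphD, fmorphV, rmorph_int) /=.
    by field.
  rewrite coordE in xE; rewrite coordE in yE.
  have k0 : x2 * y1 - x1 * y2 = 0.
    (* The cross product is (sqrt m / 2) (x_2 y_1 - x_1 y_2), as the terms in x_2 y_2 cancel; with c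
       = 2 the condition c s >= 1 reads sqrt m >= 1. *)
    apply: (cross_product_eq0 n_ge3 F_form f_monic alpha_inj alpha_root
      eps_bounds K_ge1 xE yE y0 F_le y_bigA (ltr0Sn _ 1) y_bigC (s := sm / 2)).
    - by rewrite !intrD !intrN !intrM; field.
    - by rewrite mulrC divfK ?pnatr_eq0 // ltW.
  have cross : x2 * y1 = x1 * y2 by apply/eqP; rewrite -subr_eq0 k0.
  split=> //.
  have h0 : 0 < (2^-1 : R) by rewrite invr_gt0.
  have s0 : 0 < sm / 2 by rewrite divr_gt0.
  have cross2 : x2 * (2 * y1 + y2) = (2 * x1 + x2) * y2.
    have -> : x2 * (2 * y1 + y2) = 2 * (x2 * y1) + x2 * y2 by ring.
    by rewrite cross; ring.
  have [h1 h2 h3 h4] := small_value_integers n_ge3 F_form f_monic alpha_inj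
    alpha_root eps_bounds eta_bounds K_ge1 h0 s0 xE yE y0 F_le y_bigA cross2.
  split.
  - move=> /h1[-> le1]; split=> //; apply: le_trans le1 _.
    by rewrite expr_div_n invf_div mulrC mulrAC.
  - move=> le2; have -> : 2 ^+ n * E = E / 2^-1 ^+ n.
      by rewrite exprVn invrK mulrC.
    apply: h2.
    by rewrite invrK mulrC.
  - move=> y20; have [x20 le3] := h3 y20; split=> //.
    (* [le3] now bounds |F(2 x_1, 2 y_1)| by 2^n K, and homogeneity cancels 2^n. *)
    move: le3; rewrite x20 y20 !addr0 -/(absF _ _) /absF.
    rewrite (form_evalZ _ _ _ F_form) normrM normrX intrM rmorphXn /=.
    by rewrite exprVn invrK mulrC ler_pM2r // exprn_gt0.
  - move=> le4; have -> : 2 ^+ n / sm ^+ n * E = E / (sm / 2) ^+ n.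
      by rewrite expr_div_n invf_div mulrC.
    by apply: h4; rewrite invf_div mulrC.
have case12 : m = 1 %[mod 4] \/ m = 2 %[mod 4] -> x2 * y1 = x1 * y2 /\
    [/\ y1 = 0 ->
           x1 = 0 /\ absF x2 y2 <= K / sm ^+ n,
         D <= `|y1|%:~R ->
           absF x1 y1 <= E,
         y2 = 0 ->
           x2 = 0 /\ absF x1 y1 <= K
       & D / sm <= `|y2|%:~R ->
           absF x2 y2 <= E / sm ^+ n].
  move=> m12; have [xE yE] := coord12 m12; have y_big := y_big12 m12.
  have y0 := nz _ (max_ge0 _ _) y_big.
  move: y_big; rewrite normc_normr ltcR gt_max => /andP[y_bigA y_bigC].
  have coordE (a b : int) : a%:~R + b%:~R * i_sqrt R m =
      (1 * a%:~R) +i* (sm * b%:~R) :> R[i].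
    rewrite [RHS]complexE /= Ci !(rmorphM, rmorph_int) /= rmorph1.
    by ring.
  rewrite coordE in xE; rewrite coordE in yE.
  have k0 : x2 * y1 - x1 * y2 = 0.
    (* Here c = 1 and s = sqrt m. *)
    rewrite -[constC _ _ _]mul1r in y_bigC.
    apply: (cross_product_eq0 n_ge3 F_form f_monic alpha_inj alpha_root
      eps_bounds K_ge1 xE yE y0 F_le y_bigA ltr01 y_bigC (s := sm)).
    - by rewrite !intrD !intrN !intrM; ring.
    - by rewrite mul1r ltW.
  have cross : x2 * y1 = x1 * y2 by apply/eqP; rewrite -subr_eq0 k0.
  split=> //.
  have := small_value_integers n_ge3 F_form f_monic alpha_inj
    alpha_root eps_bounds eta_bounds K_ge1 ltr01 sm0 xE yE y0 F_le y_bigA cross.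
  by rewrite expr1n !divr1.
split; last by split=> [/case3[]|/case12[]].
by case: m_cases => [/case3|m1|m2];
  [case | have [] := case12 (or_introl m1) | have [] := case12 (or_intror m2)].
Qed.
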